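(* Let $n\ge 1$, and let $f_m(a,b,c)$, $m\ge1$, be the polynomials defined by $f_1(a,b,c)=1$ and $$f_{m+1}(a,b,c)=(a+b)(a+c)\,f_m(a+1,b,c)-a^2 f_m(a,b,c).$$ Then $$(\alpha\beta\gamma)^n f_{n+1}(\alpha^{-1},\beta^{-1},\gamma^{-1})=\sum_{T}\alpha^{A(T)}\beta^{B(T)}\gamma^{C(T)},$$ where the sum is over all staircase alternative tableaux $T$ of length $2n$, and $A(T)$ is the number of cells of $T$ containing an $\alpha$, $B(T)$ is the number of cells containing a $\beta$, and $C(T)$ is the number of corners of $T$ which contain neither an $\alpha$ nor a $\beta$. Equivalently, $$(\alpha\beta\gamma)^n f_{n+1}(\alpha^{-1},\beta^{-1},\gamma^{-1})=\sum_{T}\alpha^{A'(T)}\beta^{B'(T)}\gamma^{C'(T)},$$ where the sum is over all staircase permutation tableaux $T$ of length $2n+2$, and $A'(T)$ is the number of $0$'s in the first row of $T$, $B'(T)$ is the number of restricted rows of $T$, and $C'(T)$ is the number of corners of $T$ which contain a superfluous $1$.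
   Context: Young diagrams are drawn in the English convention (row $1$ on top, rows left-justified, weakly decreasing lengths). The length of a tableau is its number of rows plus its number of columns. A staircase tableau of length $2m$ is one whose Young diagram has shape $(m,m-1,\dots,2,1)$. A corner of a diagram is a cell with no cell of the diagram to its right in its row nor below it in its column. An alternative tableau is a partial filling of a Young diagram with symbols $\alpha$ and $\beta$ (each cell is empty, or contains one $\alpha$, or contains one $\beta$) such that every cell to the left of a $\beta$ in the same row is empty, and every cell above an $\alpha$ in the same column is empty. A permutation tableau is a filling of all the cells of a Young diagram with $0$'s and $1$'s such that each column contains at least one $1$, and no $0$ has both a $1$ above it (in the same column) and a $1$ to its left (in the same row). A $0$ is restricted if it has a $1$ above it in the same column. A row is restricted if it contains a restricted $0$ (and unrestricted otherwise). A $1$ is superfluous if it is not the topmost $1$ of its column. *)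

(* Defs.v *)
From HB Require Import structures.
From mathcomp Require Import all_boot all_order all_algebra.
From mathcomp Require Import mpoly.

Set Implicit Arguments.
Unset Strict Implicit.
Unset Printing Implicit Defensive.

Import GRing.Theory.

Local Open Scope ring_scope.

Section DumontFoata.

Let a : {mpoly int[3]} := 'X_(inord 0).
Let b : {mpoly int[3]} := 'X_(inord 1).
Let c : {mpoly int[3]} := 'X_(inord 2).

(* The polynomials [f_m(a, b, c)] in the indeterminates [a], [b], [c], indexed
   by [m >= 1]; the value at [m = 0] is a dummy.  [f \mPo [tuple p; q; r]] is
   the substitution [f(p, q, r)]. *)
Fixpoint dumont_foata (m : nat) : {mpoly int[3]} :=
  match m with
  | 0%N => 0
  | 1%N => 1
  | m'.+1 => (a + b) * (a + c) * (dumont_foata m' \mPo [tuple a + 1; b; c])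
             - a ^+ 2 * dumont_foata m'
  end.

End DumontFoata.

Definition eval3 (R : comNzRingType) (p : {mpoly int[3]}) (x y z : R) : R :=
  (map_mpoly intr p).@[tnth [tuple x; y; z]].

Local Open Scope nat_scope.

(* A Young diagram is given by its row lengths, from top to bottom. *)
Record diagram := Diagram {
  rowlens :> seq nat;
  rowlens_sorted : sorted geq rowlens
}.

Definition nrows (D : diagram) : nat := size D.
Definition ncols (D : diagram) : nat := head 0 D.

Definition diagram_length (D : diagram) : nat := nrows D + ncols D.

(* Cells are (row, column) pairs, 0-based, row 0 being the top row (English
   convention). *)
Definition cell (D : diagram) : Type :=
  {x : 'I_(nrows D) * 'I_(ncols D) | x.2 < nth 0 D x.1}.

Definition cell_row (D : diagram) (x : cell D) : 'I_(nrows D) := (val x).1.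
Definition cell_col (D : diagram) (x : cell D) : 'I_(ncols D) := (val x).2.

Definition left_of (D : diagram) (x y : cell D) : bool :=
  (cell_row x == cell_row y) && (cell_col x < cell_col y).
Definition above (D : diagram) (x y : cell D) : bool :=
  (cell_col x == cell_col y) && (cell_row x < cell_row y).

Definition corner (D : diagram) (x : cell D) : bool :=
  [forall y : cell D, ~~ left_of x y && ~~ above x y].

Lemma staircase_sorted (m : nat) : sorted geq (rev (iota 1 m)).
Proof. by rewrite rev_sorted; exact: iota_sorted. Qed.

(* The shape [(m, m - 1, ..., 2, 1)]. *)
Definition staircase (m : nat) : diagram := Diagram (staircase_sorted m).

Lemma staircase_length (m : nat) : diagram_length (staircase m) = m.*2.
Proof.
rewrite /diagram_length /nrows /ncols /= size_rev size_iota -addnn.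
by case: m => // m; rewrite -{2}[m.+1]addn1 iotaD rev_cat.
Qed.

Inductive symbol := Alpha | Beta.

Definition symbol_to_bool (s : symbol) : bool :=
  if s is Alpha then true else false.
Definition bool_to_symbol (b : bool) : symbol := if b then Alpha else Beta.
Lemma symbol_to_boolK : cancel symbol_to_bool bool_to_symbol.
Proof. by case. Qed.
HB.instance Definition _ := Finite.copy symbol (can_type symbol_to_boolK).

Section AlternativeTableaux.

Variable D : diagram.

(* Partial fillings: [None] is an empty cell. *)
Definition afilling := {ffun cell D -> option symbol}.

Implicit Type T : afilling.

Definition is_alternative T : bool :=
  [forall x, (T x == Some Beta) ==> [forall y, left_of y x ==> (T y == None)]]
  && [forall x, (T x == Some Alpha) ==> [forall y, above y x ==> (T y == None)]].

Definition num_alpha T : nat := #|[set x | T x == Some Alpha]|.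
Definition num_beta T : nat := #|[set x | T x == Some Beta]|.
Definition num_empty_corners T : nat := #|[set x | corner x && (T x == None)]|.

End AlternativeTableaux.

Section PermutationTableaux.

Variable D : diagram.

(* Fillings with 0 and 1, encoded as [false] and [true]. *)
Definition pfilling := {ffun cell D -> bool}.

Implicit Type T : pfilling.

Definition one_above T (x : cell D) : bool := [exists y, above y x && T y].
Definition one_left T (x : cell D) : bool := [exists y, left_of y x && T y].

Definition is_permutation T : bool :=
  [forall j : 'I_(ncols D), exists x, (cell_col x == j) && T x]
  && [forall x, ~~ T x ==> ~~ (one_above T x && one_left T x)].

Definition restricted_zero T (x : cell D) : bool := ~~ T x && one_above T x.
Definition restricted_row T (i : 'I_(nrows D)) : bool :=
  [exists x, (cell_row x == i) && restricted_zero T x].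

Definition topmost_one T (x : cell D) : bool := T x && ~~ one_above T x.
Definition superfluous_one T (x : cell D) : bool := T x && ~~ topmost_one T x.

Definition num_zeros_first_row T : nat :=
  #|[set x | (cell_row x == 0 :> nat) && ~~ T x]|.
Definition num_restricted_rows T : nat := #|[set i | restricted_row T i]|.
Definition num_superfluous_corners T : nat :=
  #|[set x | corner x && superfluous_one T x]|.

End PermutationTableaux.

(* Main.v *)
Require Import Defs.
From mathcomp Require Import all_boot all_order all_algebra.
From mathcomp Require Import mpoly ring zify.

Set Implicit Arguments.
Unset Strict Implicit.
Unset Printing Implicit Defensive.

Import GRing.Theory.
Local Open Scope ring_scope.

(** Weight an alternative tableau [T] of staircase shape [(n, ..., 1)] by
    [alpha ^ A(T) * beta ^ B(T) * gamma ^ C(T)], and refine the generating function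
    by a factor [x] for each column without an alpha; call the result [G_n(x)], which
    is [alternative_sum] below.

    Removing the first row of the staircase of size [n + 1] leaves the staircase of
    size [n], and the rows that may be put on top of a tableau [T] of size [n] depend
    on [T] only through the set of its columns without an alpha: the other columns
    must be empty in the new row, and everything to the left of a beta of the new row
    must be empty ([is_alternative_stack]).  Build the new row from left to right,
    with [k] free columns among the first [n].  A row without a beta contributes
    [x + alpha] for each free column, and a beta forces the columns to its left to
    be empty, so that they contribute a factor [x] each.  Summing the geometric
    progression over the position of the beta, and giving the last cell, which is a
    corner, its weight [gamma] when it is empty, the total weight of the new rows,
    times [alpha], is
      [(gamma x + alpha) (beta x + alpha) (x + alpha)^k - beta gamma x^2 x^k].
    Hence ([alternative_sumS])
      [alpha G_{n+1}(x) = (gamma x + alpha) (beta x + alpha) G_n(x + alpha)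
                          - beta gamma x^2 G_n(x)].
    For [x = alpha a] this is the recurrence of the Dumont-Foata polynomials, in which
    the shift of [x] by [alpha] becomes the shift of [a] by [1]; therefore
      [G_n(x) = (alpha beta gamma)^n f_{n+1}(x / alpha, 1 / beta, 1 / gamma)]
    ([alternative_sumE]), and [x = 1] gives the first identity.

    The second identity follows from a bijection between the permutation tableaux of
    the staircase of size [n + 1] and the alternative tableaux of the staircase of
    size [n], which is the former without its first row.  Below the first row, put an
    alpha on each topmost one, and a beta on the rightmost restricted zero of each
    restricted row.  To go back, let an alpha annihilate the cells above it,
    and a beta its own cell and the cells to its left, where the betas of [T] act one
    row lower in the larger diagram; the annihilated cells are the zeros.  The three
    statistics correspond: a first row zero lies over a column whose topmost one is
    lower, hence over an alpha; restricted rows are the rows with a beta; and a corner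
    below the first row is a topmost one, a restricted zero or a superfluous one,
    since it is the last cell of its column and the column contains a one. *)

(** * Evaluation of the Dumont-Foata polynomials *)

(** The coefficient morphism is arbitrary, because the morphism from the integers to
    a ring of positive characteristic is not injective. *)
Lemma meval_map_mpoly_comp (R S : comNzRingType) (f : {rmorphism R -> S})
    (n k : nat) (v : 'I_k -> S) (lq : n.-tuple {mpoly R[k]}) (p : {mpoly R[n]}) :
  (map_mpoly f (p \mPo lq)).@[v]
  = (map_mpoly f p).@[fun i => (map_mpoly f (tnth lq i)).@[v]].
Proof.
have -> : p \mPo lq = \sum_(m <- msupp p) (p@_m)%:MP * mmap1 (tnth lq) m by [].
rewrite [map_mpoly f (\sum_(_ <- _) _)]raddf_sum /=.
have -> : map_mpoly f p = \sum_(m <- msupp p) (f p@_m)%:MP * mmap1 (fun i => 'X_i) m.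
  by [].
rewrite !raddf_sum; apply: eq_bigr => m _ /=.
rewrite !rmorphM /=. rewrite map_mpolyC !mevalC; congr (_ * _).
rewrite mmap1_id mevalX /mmap1 !rmorph_prod.
by apply: eq_bigr => i _; rewrite /= !rmorphXn.
Qed.

Lemma map_mpolyU (R S : comNzRingType) (f : {rmorphism R -> S}) (n : nat)
    (i : 'I_n) : map_mpoly f 'X_i = 'X_i.
Proof. by rewrite /map_mpoly mmapX mmap1U. Qed.

Lemma eval3_dumont_foata1 (R : comNzRingType) (x y z : R) :
  eval3 (dumont_foata 1) x y z = 1.
Proof. by rewrite /eval3 /= !rmorph1. Qed.

Lemma eval3_dumont_foataS (R : comNzRingType) (m : nat) (x y z : R) :
  eval3 (dumont_foata m.+2) x y z =
  (x + y) * (x + z) * eval3 (dumont_foata m.+1) (x + 1) y z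
  - x ^+ 2 * eval3 (dumont_foata m.+1) x y z.
Proof.
have X0 : (map_mpoly intr ('X_(inord 0) : {mpoly int[3]})).@[tnth [tuple x; y; z]] = x.
  by rewrite map_mpolyU mevalXU (tnth_nth 0) inordK.
have X1 : (map_mpoly intr ('X_(inord 1) : {mpoly int[3]})).@[tnth [tuple x; y; z]] = y.
  by rewrite map_mpolyU mevalXU (tnth_nth 0) inordK.
have X2 : (map_mpoly intr ('X_(inord 2) : {mpoly int[3]})).@[tnth [tuple x; y; z]] = z.
  by rewrite map_mpolyU mevalXU (tnth_nth 0) inordK.
have -> : dumont_foata m.+2
    = ('X_(inord 0) + 'X_(inord 1)) * ('X_(inord 0) + 'X_(inord 2))
      * (dumont_foata m.+1 \mPo [tuple 'X_(inord 0) + 1; 'X_(inord 1); 'X_(inord 2)])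
      - 'X_(inord 0) ^+ 2 * dumont_foata m.+1 by [].
move: (dumont_foata m.+1) => p.
rewrite /eval3 !(rmorphB, rmorphM, rmorphD) /= X0 X1 X2 meval_map_mpoly_comp.
congr (_ * _ - _).
apply: meval_eq => i.
case: i => [[|[|[|//]]] lti]; rewrite !(tnth_nth 0) /=.
- by rewrite rmorphD mevalD X0 !rmorph1.
- exact: X1.
- exact: X2.
Qed.

(** * Cells of a staircase *)

Section Cells.
Local Open Scope nat_scope.

Definition row_of (D : diagram) (x : cell D) : nat := cell_row x.
Definition col_of (D : diagram) (x : cell D) : nat := cell_col x.

Lemma left_ofE (D : diagram) (x y : cell D) :
  left_of x y = (row_of x == row_of y) && (col_of x < col_of y).
Proof. by []. Qed.

Lemma aboveE (D : diagram) (x y : cell D) :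
  above x y = (col_of x == col_of y) && (row_of x < row_of y).
Proof. by []. Qed.

Lemma cell_eq (D : diagram) (x y : cell D) :
  row_of x = row_of y -> col_of x = col_of y -> x = y.
Proof.
move=> eqr eqc; apply: val_inj.
case: x y eqr eqc => [[i j] /= ?] [[k l] /= ?].
by rewrite /row_of /col_of /cell_row /cell_col /= => /val_inj -> /val_inj ->.
Qed.

Lemma nrows_staircase (n : nat) : nrows (staircase n) = n.
Proof. by rewrite /nrows /= size_rev size_iota. Qed.

Lemma nth_staircase (n i : nat) : i < n -> nth 0 (staircase n) i = n - i.
Proof.
move=> ltin; rewrite /= nth_rev ?size_iota // nth_iota; lia.
Qed.

Lemma ncols_staircase (n : nat) : ncols (staircase n) = n.
Proof.
by case: n => // n; rewrite /ncols -nth0 nth_staircase.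
Qed.

Lemma staircase_cellP (n : nat) (x : cell (staircase n)) : row_of x + col_of x < n.
Proof.
have ltr : row_of x < n by rewrite -{2}(nrows_staircase n); exact: ltn_ord.
have : col_of x < nth 0 (staircase n) (row_of x) := valP x.
by rewrite nth_staircase //; lia.
Qed.

Fact staircase_row_bound n i j : i + j < n -> i < nrows (staircase n).
Proof. by rewrite nrows_staircase; lia. Qed.

Fact staircase_col_bound n i j : i + j < n -> j < ncols (staircase n).
Proof. by rewrite ncols_staircase; lia. Qed.

Fact staircase_cell_bound n i j : i + j < n -> j < nth 0 (staircase n) i.
Proof. by move=> ltij; rewrite nth_staircase; lia. Qed.

Definition stair_cell n i j (ltij : i + j < n) : cell (staircase n) :=
  Sub (Ordinal (staircase_row_bound ltij), Ordinal (staircase_col_bound ltij))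
      (staircase_cell_bound ltij).

Lemma cornerE n (x : cell (staircase n)) :
  corner x = ((row_of x + col_of x).+1 == n).
Proof.
have ltx := staircase_cellP x; apply/forallP/eqP => [cx | eqn y]; last first.
  have := staircase_cellP y; rewrite left_ofE aboveE; lia.
apply/eqP; rewrite eqn_leq ltx leqNgt; apply/negP => ltn.
have lty : row_of x + (col_of x).+1 < n by rewrite addnS.
by have := cx (stair_cell lty); rewrite left_ofE /= /row_of /col_of /= eqxx leqnn.
Qed.

Variable n : nat.

Fact top_bound (j : 'I_n.+1) : 0 + j < n.+1. Proof. exact: ltn_ord. Qed.
Definition top_cell (j : 'I_n.+1) : cell (staircase n.+1) := stair_cell (top_bound j).

Fact low_bound (x : cell (staircase n)) : (row_of x).+1 + col_of x < n.+1.
Proof. exact: staircase_cellP. Qed.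
Definition low_cell (x : cell (staircase n)) : cell (staircase n.+1) :=
  stair_cell (low_bound x).

Lemma row_top j : row_of (top_cell j) = 0. Proof. by []. Qed.
Lemma col_top j : col_of (top_cell j) = j. Proof. by []. Qed.
Lemma row_low x : row_of (low_cell x) = (row_of x).+1. Proof. by []. Qed.
Lemma col_low x : col_of (low_cell x) = col_of x. Proof. by []. Qed.

(** The staircase of size [n + 1] is its first row on top of a staircase of size [n];
    [stair_join] and [stair_split] are the two directions of this decomposition. *)
Definition stair_join (u : 'I_n.+1 + cell (staircase n)) : cell (staircase n.+1) :=
  match u with inl j => top_cell j | inr x => low_cell x end.

Fact split_bound (c : cell (staircase n.+1)) :
  0 < row_of c -> (row_of c).-1 + col_of c < n.
Proof. have := staircase_cellP c; lia. Qed.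

Definition stair_split (c : cell (staircase n.+1)) : 'I_n.+1 + cell (staircase n) :=
  match (0 < row_of c) =P true with
  | ReflectT ltc => inr (stair_cell (split_bound ltc))
  | ReflectF _ => inl (inord (col_of c))
  end.

Lemma stair_splitK : cancel stair_split stair_join.
Proof.
move=> c; have ltc := staircase_cellP c; rewrite /stair_split.
case: eqP => hc; apply: cell_eq => /=; rewrite ?row_low ?col_low //.
- by rewrite prednK.
- by rewrite row_top; lia.
- by rewrite col_top inordK //; lia.
Qed.

Lemma stair_joinK : cancel stair_join stair_split.
Proof.
case=> [j | x] /=; rewrite /stair_split; case: eqP => //= hc.
- by rewrite col_top inord_val.
- by congr inr; apply: cell_eq.
Qed.

Lemma stair_ind (P : cell (staircase n.+1) -> Prop) :
  (forall j, P (top_cell j)) -> (forall x, P (low_cell x)) -> forall c, P c.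
Proof. by move=> Pt Pl c; rewrite -(stair_splitK c); case: stair_split. Qed.

Lemma low_cell_inj : injective low_cell.
Proof.
move=> x y e; apply: cell_eq; last by rewrite -!col_low e.
by apply: succn_inj; rewrite -!row_low e.
Qed.

End Cells.

(** * The sum over the rows that can be put on top of a tableau *)

Lemma is_alternativeP (D : diagram) (T : afilling D) :
  reflect ((forall x y, T x = Some Beta -> row_of y = row_of x ->
              (col_of y < col_of x)%N -> T y = None) /\
           (forall x y, T x = Some Alpha -> col_of y = col_of x ->
              (row_of y < row_of x)%N -> T y = None))
          (is_alternative T).
Proof.
apply: (iffP andP) => -[hB hA]; split.
- move=> x y Tx e lt; move/forallP/(_ x): hB; rewrite Tx eqxx /= => /forallP/(_ y).
  by rewrite left_ofE e eqxx lt /= => /eqP.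
- move=> x y Tx e lt; move/forallP/(_ x): hA; rewrite Tx eqxx /= => /forallP/(_ y).
  by rewrite aboveE e eqxx lt /= => /eqP.
- apply/forallP => x; apply/implyP => /eqP Tx; apply/forallP => y.
  by apply/implyP; rewrite left_ofE => /andP[/eqP e lt]; apply/eqP/(hB x).
- apply/forallP => x; apply/implyP => /eqP Tx; apply/forallP => y.
  by apply/implyP; rewrite aboveE => /andP[/eqP e lt]; apply/eqP/(hA x).
Qed.

Section RowSum.
Variables (R : comNzRingType) (alpha beta : R).

Definition row_ok m (r : {ffun 'I_m -> option symbol}) : bool :=
  [forall j, (r j == Some Beta) ==> [forall k : 'I_m, (k < j)%N ==> (r k == None)]].

(** The factor contributed by an entry [s] of a new first row, where [u] says that the
    column has no alpha yet and [y] is the factor of an empty cell of such a column.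
    The column keeps its factor [x] under a beta and loses it under an alpha.  A column
    that already has an alpha accepts only an empty cell: other entries weigh 0, so
    that this constraint needs no separate condition on rows. *)
Definition row_weight (x y : R) (u : bool) (s : option symbol) : R :=
  if u then match s with
            | None => y
            | Some Alpha => alpha
            | Some Beta => beta * x
            end
  else (s == None)%:R.

Definition row_sum m (v : nat -> option symbol -> R) : R :=
  \sum_(r : {ffun 'I_m -> option symbol} | row_ok r) \prod_(j < m) v j (r j).

Definition row_rcons m (p : {ffun 'I_m -> option symbol} * option symbol) :
    {ffun 'I_m.+1 -> option symbol} :=
  [ffun j => oapp p.1 p.2 (unlift ord_max j)].

Lemma row_rcons_lift m p (j : 'I_m) : row_rcons p (lift ord_max j) = p.1 j.
Proof. by rewrite ffunE liftK. Qed.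

Lemma row_rcons_max m (p : {ffun 'I_m -> option symbol} * option symbol) :
  row_rcons p ord_max = p.2.
Proof. by rewrite ffunE unlift_none. Qed.

Lemma row_rcons_bij m : bijective (@row_rcons m).
Proof.
exists (fun r : {ffun 'I_m.+1 -> option symbol} =>
          ([ffun j => r (lift ord_max j)], r ord_max)).
  move=> [r s]; rewrite row_rcons_max; congr pair; apply/ffunP => j.
  by rewrite ffunE row_rcons_lift.
move=> r; apply/ffunP => j.
by case: (unliftP ord_max j) => [k ->|->];
  rewrite ?row_rcons_lift ?row_rcons_max ?ffunE.
Qed.

Lemma row_ok_rcons m (r : {ffun 'I_m -> option symbol}) s :
  row_ok (row_rcons (r, s))
  = if s == Some Beta then r == [ffun=> None] else row_ok r.
Proof.
apply/forallP/idP => [h | h j].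
  case: ifPn => [/eqP sB | _].
    move: (h ord_max); rewrite row_rcons_max sB eqxx => /forallP h'.
    apply/eqP/ffunP => j; rewrite ffunE.
    by have := h' (lift ord_max j);
      rewrite row_rcons_lift lift_max ltn_ord => /eqP.
  apply/forallP => j; apply/implyP => rj; apply/forallP => k; apply/implyP => lt.
  move: (h (lift ord_max j)); rewrite row_rcons_lift rj => /forallP/(_ (lift ord_max k)).
  by rewrite row_rcons_lift !lift_max lt.
apply/implyP; case: (unliftP ord_max j) => [j' ->|->]; last first.
  rewrite row_rcons_max => sB; rewrite sB in h; rewrite (eqP h).
  apply/forallP => k; case: (unliftP ord_max k) => [k' ->|->].
    by rewrite row_rcons_lift ffunE eqxx implybT.
  by rewrite ltnn.
rewrite row_rcons_lift => rj.
have ok : row_ok r.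
  by move: h; case: ifP => // _ /eqP r0; rewrite r0 ffunE in rj.
apply/forallP => k; case: (unliftP ord_max k) => [k' ->|->].
  by move/forallP/(_ j'): ok; rewrite rj row_rcons_lift !lift_max => /forallP/(_ k').
by rewrite lift_max /= ltnNge ltnW.
Qed.

Lemma sum_option_symbol (F : option symbol -> R) :
  \sum_s F s = F None + F (Some Alpha) + F (Some Beta).
Proof.
rewrite (bigD1 None) //= (bigD1 (Some Alpha)) //= (bigD1 (Some Beta)) //=.
by rewrite big1 ?addr0 ?addrA // => -[[]|] //=.
Qed.

(** If the last entry is a beta, the others are empty; otherwise it does not constrain
    them. *)
Lemma row_sumS m v :
  row_sum m.+1 v = (v m None + v m (Some Alpha)) * row_sum m v
                   + v m (Some Beta) * \prod_(j < m) v j None.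
Proof.
rewrite /row_sum (reindex (@row_rcons m)); last exact/onW_bij/row_rcons_bij.
under eq_bigr => p _.
  rewrite big_ord_recr /= row_rcons_max.
  under eq_bigr => j _.
    have -> : widen_ord (leqnSn m) j = lift ord_max j.
      exact/val_inj/esym/lift_max.
    rewrite row_rcons_lift.
    over.
  over.
rewrite big_mkcond /=.
rewrite -(pair_bigA _ (fun r s => if row_ok (row_rcons (r, s))
   then (\prod_(j < m) v j (r j)) * v m s else 0)) /=.
rewrite exchange_big /= sum_option_symbol.
under eq_bigr => r _ do rewrite row_ok_rcons /=.
under [X in _ + X + _]eq_bigr => r _ do rewrite row_ok_rcons /=.
under [X in _ + _ + X]eq_bigr => r _ do rewrite row_ok_rcons eqxx.
rewrite -!big_mkcond -!mulr_suml big_pred1_eq /= mulrDl.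
congr (_ + _ + _); rewrite mulrC //; congr (_ * _).
by apply: eq_bigr => j _; rewrite ffunE.
Qed.

Lemma eq_row_sum m v w :
  (forall j s, (j < m)%N -> v j s = w j s) -> row_sum m v = row_sum m w.
Proof.
by move=> e; apply: eq_bigr => r _; apply: eq_bigr => j _; rewrite e.
Qed.

(** The closed form of the geometric progression over the position of the beta; the
    factor [alpha] is the denominator [(x + alpha) - x]. *)
Lemma row_sum_free (x : R) (u : nat -> bool) m :
  alpha * row_sum m (fun j => row_weight x x (u j))
  = (alpha + beta * x) * \prod_(j < m) (if u j then x + alpha else 1)
    - beta * x * \prod_(j < m) (if u j then x else 1).
Proof.
elim: m => [|m IH].
  rewrite /row_sum !big_ord0.
  rewrite (eq_bigl predT) => [|r]; last by apply/forallP => -[].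
  rewrite (big_pred1 [ffun=> None]) => [|r]; last first.
    by apply/esym/eqP/ffunP => -[].
  by rewrite big_ord0; ring.
rewrite row_sumS !big_ord_recr /= mulrDr mulrCA IH /row_weight.
have -> : \prod_(j < m) (if u j then x else (None == None :> option symbol)%:R)
    = \prod_(j < m) (if u j then x else 1) by [].
by case: (u m) => /=; ring.
Qed.

End RowSum.

(** * Adding a first row *)

Section Stacking.

Definition alpha_free (D : diagram) (T : afilling D) (j : nat) : bool :=
  [forall x, (col_of x == j) ==> (T x != Some Alpha)].

Lemma alpha_freePn (D : diagram) (T : afilling D) j :
  reflect (exists2 x, col_of x = j & T x = Some Alpha) (~~ alpha_free T j).
Proof.
rewrite negb_forall; apply: (iffP existsP) => -[x].
  by rewrite negb_imply negbK => /andP[/eqP ? /eqP ?]; exists x.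
by move=> e Tx; exists x; rewrite e Tx !eqxx.
Qed.

Variable n : nat.

(** [T] has no cell in column [n], where only the new row has one. *)
Lemma alpha_free_last (T : afilling (staircase n)) : alpha_free T n.
Proof.
apply/forallP => z; apply/implyP => /eqP e.
by have := staircase_cellP z; rewrite e; lia.
Qed.

Definition stack (p : {ffun 'I_n.+1 -> option symbol} * afilling (staircase n)) :
    afilling (staircase n.+1) :=
  [ffun c => match stair_split c with inl j => p.1 j | inr x => p.2 x end].

Lemma stack_top p j : stack p (top_cell j) = p.1 j.
Proof. by rewrite ffunE (stair_joinK (inl j)). Qed.

Lemma stack_low p x : stack p (low_cell x) = p.2 x.
Proof. by rewrite ffunE (stair_joinK (inr x)). Qed.

Lemma stack_bij : bijective stack.
Proof.
exists (fun T : afilling (staircase n.+1) =>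
          ([ffun j => T (top_cell j)], [ffun x => T (low_cell x)])).
  move=> [r T]; congr pair; apply/ffunP => z;
    by rewrite ffunE ?stack_top ?stack_low.
by move=> T; apply/ffunP; apply: stair_ind => z; rewrite ?stack_top ?stack_low ffunE.
Qed.

Lemma corner_top (j : 'I_n.+1) : corner (top_cell j) = (j == n :> nat).
Proof. by rewrite cornerE row_top col_top. Qed.

Lemma corner_low (x : cell (staircase n)) : corner (low_cell x) = corner x.
Proof. by rewrite !cornerE row_low col_low. Qed.

Lemma alpha_free_stack r T (j : 'I_n.+1) :
  alpha_free (stack (r, T)) j = alpha_free T j && (r j != Some Alpha).
Proof.
apply/idP/andP => [/forallP h | [/forallP hT rj]].
  split; last by have := h (top_cell j); rewrite col_top stack_top eqxx.
  by apply/forallP => x; have := h (low_cell x); rewrite col_low stack_low.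
apply/forallP; apply: stair_ind => [k | x].
  by apply/implyP; rewrite stack_top col_top => /eqP/val_inj ->.
by rewrite stack_low col_low.
Qed.

(** A symbol of the new row interacts with [T] in one way only: nothing may be placed
    above an alpha. *)
Lemma is_alternative_stack r T :
  is_alternative (stack (r, T))
  = [&& is_alternative T, row_ok r &
        [forall j : 'I_n.+1, ~~ alpha_free T j ==> (r j == None)]].
Proof.
apply/is_alternativeP/and3P => [[hB hA] | [/is_alternativeP[hB hA] /forallP ok /forallP hr]].
  split.
  - apply/is_alternativeP; split=> x y.
      move=> Tx e lt; rewrite -(stack_low (r, T)); apply: (hB (low_cell x)).
      - by rewrite stack_low.
      - by rewrite !row_low e.
      - by rewrite !col_low.
    move=> Tx e lt; rewrite -(stack_low (r, T)); apply: (hA (low_cell x)).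
    - by rewrite stack_low.
    - by rewrite !col_low e.
    - by rewrite !row_low.
  - apply/forallP => j; apply/implyP => /eqP rj.
    apply/forallP => k; apply/implyP => lt; apply/eqP.
    by rewrite -(stack_top (r, T)); apply: (hB (top_cell j)); rewrite ?stack_top.
  - apply/forallP => j; apply/implyP => /alpha_freePn[x xj Tx]; apply/eqP.
    by rewrite -(stack_top (r, T)); apply: (hA (low_cell x)); rewrite ?stack_low.
split; elim/stair_ind => [j | x]; elim/stair_ind => [k | y];
  rewrite ?stack_top ?stack_low ?row_top ?row_low ?col_top ?col_low //=.
- move=> rj _ lt; apply/eqP.
  by have := ok j; rewrite rj => /forallP/(_ k); rewrite lt.
- by move=> Tx [e]; apply: hB Tx e.
- move=> Tx e _; apply/eqP; have := hr k; rewrite (_ : ~~ _) //.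
  by apply/alpha_freePn; exists x.
- exact: hA.
Qed.

Lemma prod_stair (R : comNzRingType) (F : cell (staircase n.+1) -> R) :
  \prod_c F c = \prod_j F (top_cell j) * \prod_x F (low_cell x).
Proof.
rewrite (reindex (@stair_join n)) ?big_sumType //.
by apply: onW_bij; exists (@stair_split n);
  [exact: stair_joinK | exact: stair_splitK].
Qed.

End Stacking.

Section Recurrence.
Variables (R : comNzRingType) (alpha beta gamma : R).

Definition entry_weight (D : diagram) (T : afilling D) (x : cell D) : R :=
  match T x with
  | Some Alpha => alpha
  | Some Beta => beta
  | None => if corner x then gamma else 1
  end.

Lemma expr_card (I : finType) (P : pred I) (c : R) :
  c ^+ #|[set i | P i]| = \prod_i (if P i then c else 1).
Proof. by rewrite -prodr_const big_mkcond; apply: eq_bigr => i _; rewrite inE. Qed.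

Lemma prod_entry_weight (D : diagram) (T : afilling D) :
  \prod_x entry_weight T x
  = alpha ^+ num_alpha T * beta ^+ num_beta T * gamma ^+ num_empty_corners T.
Proof.
rewrite /num_alpha /num_beta /num_empty_corners !expr_card -!big_split /=.
apply: eq_bigr => x _; rewrite /entry_weight.
by case: (T x) => [[]|]; rewrite ?andbF ?andbT /= ?mulr1 ?mul1r.
Qed.

(** The parameter [x] records the columns without an alpha, which is all that the next
    row depends on. *)
Definition alternative_sum n (x : R) : R :=
  \sum_(T : afilling (staircase n) | is_alternative T)
     (\prod_z entry_weight T z) * \prod_(j < n) (if alpha_free T j then x else 1).

Lemma alternative_sum_rows n x :
  alternative_sum n.+1 x =
  \sum_(T : afilling (staircase n) | is_alternative T)
     (\prod_z entry_weight T z) *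
     row_sum n.+1 (fun j => row_weight alpha beta x
       (if j == n then gamma * x else x) (alpha_free T j)).
Proof.
rewrite /alternative_sum (reindex (@stack n)); last exact/onW_bij/stack_bij.
rewrite big_mkcond /= -(pair_bigA _ (fun r T => if is_alternative (stack (r, T))
  then (\prod_z entry_weight (stack (r, T)) z)
         * (\prod_(j < n.+1) (if alpha_free (stack (r, T)) j then x else 1))
  else 0)) exchange_big /=.
rewrite [RHS]big_mkcond; apply: eq_bigr => T _.
under eq_bigr => r _ do rewrite is_alternative_stack.
case: (is_alternative T) => /=; last by rewrite big1.
rewrite [in RHS]/row_sum mulr_sumr [RHS]big_mkcond; apply: eq_bigr => r _.
case: (row_ok r) => //=.
case: ifP => [/forallP h | /negbT].
  rewrite prod_stair mulrAC mulrC; congr (_ * _).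
    by apply: eq_bigr => z _; rewrite /entry_weight stack_low corner_low.
  rewrite -big_split; apply: eq_bigr => j _ /=.
  rewrite alpha_free_stack /entry_weight stack_top corner_top /row_weight /=.
  have := h j; case nf: (alpha_free T j) => /=.
    by case: (r j) => [[]|] _; rewrite ?mulr1 //; case: ifP; rewrite ?mul1r.
  by move=> /eqP ->; case: eqP nf => [->|]; rewrite ?alpha_free_last ?mul1r.
rewrite negb_forall => /existsP[j]; rewrite negb_imply => /andP[nf rj].
by rewrite (bigD1 j) //= /row_weight (negbTE nf) (negbTE rj) mul0r mulr0.
Qed.

(** Applying [row_sumS] to the corner and [row_sum_free] to the other cells. *)
Lemma alternative_sumS n x :
  alpha * alternative_sum n.+1 x
  = (gamma * x + alpha) * (beta * x + alpha) * alternative_sum n (x + alpha)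
    - beta * gamma * x ^+ 2 * alternative_sum n x.
Proof.
rewrite alternative_sum_rows /alternative_sum !mulr_sumr -sumrB.
apply: eq_bigr => T _.
rewrite row_sumS eqxx alpha_free_last.
rewrite (@eq_row_sum _ n _ (fun j => row_weight alpha beta x x (alpha_free T j)));
  last by move=> j s lt; rewrite ltn_eqF.
rewrite (eq_bigr (fun j : 'I_n => if alpha_free T j then x else 1)); last first.
  by move=> j _; rewrite ltn_eqF // /row_weight; case: (alpha_free T j).
have W := row_sum_free alpha beta x (alpha_free T) n.
move: (row_sum _ _) W => W e; rewrite /row_weight.
set P := \prod_z _; set Q' := \prod_(j < n) _ in e *.
set Q := \prod_(j < n) _ in e *.
(* The factor [alpha] is moved onto [W], for which [e] is stated. *)
transitivity (P * ((gamma * x + alpha) * (alpha * W) + alpha * beta * x * Q)).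
  by ring.
rewrite e; ring.
Qed.

End Recurrence.

Lemma alternative_sumE (F : fieldType) (alpha beta gamma x : F) n :
  alpha != 0 -> beta != 0 -> gamma != 0 ->
  alternative_sum alpha beta gamma n x
  = (alpha * beta * gamma) ^+ n
    * eval3 (dumont_foata n.+1) (x / alpha) beta^-1 gamma^-1.
Proof.
move=> a0 b0 c0; elim: n x => [|n IH] x.
  rewrite /alternative_sum eval3_dumont_foata1 mulr1 expr0.
  have no_cell (z : cell (staircase 0)) : False by have := staircase_cellP z.
  rewrite (big_pred1 [ffun=> None]) => [|T].
    by rewrite big_ord0 mulr1 big1 // => z; case: (no_cell z).
  have -> : T = [ffun=> None] by apply/ffunP => z; case: (no_cell z).
  by rewrite /= eqxx; apply/is_alternativeP; split=> z; case: (no_cell z).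
apply: (mulfI a0); rewrite alternative_sumS !IH eval3_dumont_foataS.
have -> : (x + alpha) / alpha = x / alpha + 1 by rewrite mulrDl divff.
move: (eval3 _ _ _ _) (eval3 _ _ _ _) => p q; rewrite (exprS (_ * _)).
move: (_ ^+ n) => t. field; by rewrite a0 b0 c0.
Qed.

(** * From alternative to permutation tableaux and back *)

Section Bijection.
Local Open Scope nat_scope.
Variable n : nat.
Implicit Types (T : afilling (staircase n)) (P : pfilling (staircase n.+1)).

Lemma is_permutationP (D : diagram) (P : pfilling D) :
  reflect ((forall j, j < ncols D -> exists2 x, col_of x = j & P x) /\
           (forall x y z, P x -> P y -> P z = false ->
              col_of x = col_of z -> row_of x < row_of z ->
              row_of y = row_of z -> col_of y < col_of z -> False))
          (is_permutation P).
Proof.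
apply: (iffP andP) => -[hcol hz]; split.
- move=> j lt; have /existsP[x /andP[/eqP e Px]] := forallP hcol (Ordinal lt).
  by exists x; rewrite // /col_of e.
- move=> x y z Px Py Pz ec lr er lc; move/forallP/(_ z): hz.
  rewrite Pz /= => /negP; apply; apply/andP; split; apply/existsP.
    by exists x; rewrite aboveE ec eqxx lr.
  by exists y; rewrite left_ofE er eqxx lc.
- apply/forallP => j; have [x e Px] := hcol _ (ltn_ord j).
  by apply/existsP; exists x; rewrite Px andbT; apply/eqP/val_inj.
- apply/forallP => z; apply/implyP => /negbTE Pz; apply/negP => /andP[].
  move=> /existsP[x]; rewrite aboveE => /andP[/andP[/eqP ec lr] Px].
  move=> /existsP[y]; rewrite left_ofE => /andP[/andP[/eqP er lc] Py].
  exact: (hz x y z).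
Qed.

Lemma one_aboveP (D : diagram) (P : pfilling D) x :
  reflect (exists y, [/\ col_of y = col_of x, row_of y < row_of x & P y])
          (one_above P x).
Proof.
apply: (iffP existsP) => -[y].
  by rewrite aboveE => /andP[/andP[/eqP]]; exists y.
by case=> e lt Py; exists y; rewrite aboveE e eqxx lt.
Qed.

(** A cell is zero exactly when an arrow passes through it: a beta of [T] points left
    from its own cell on, and an alpha points up from the cell above it.  Row [i] of
    [T] is row [i + 1] of the result, hence the shifted comparisons. *)
Definition to_permutation T : pfilling (staircase n.+1) :=
  [ffun c =>
     ~~ [exists y, [&& row_of c == (row_of y).+1, col_of c <= col_of y
                     & T y == Some Beta]]
     && ~~ [exists y, [&& row_of c <= row_of y, col_of c == col_of y
                        & T y == Some Alpha]]].

Definition to_alternative P : afilling (staircase n) :=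
  [ffun x =>
     if topmost_one P (low_cell x) then Some Alpha
     else if restricted_zero P (low_cell x)
             && ~~ [exists y, left_of x y && restricted_zero P (low_cell y)]
     then Some Beta else None].

Lemma to_permutationPn T c :
  reflect (exists y, row_of c = (row_of y).+1 /\ col_of c <= col_of y /\ T y = Some Beta
             \/ row_of c <= row_of y /\ col_of c = col_of y /\ T y = Some Alpha)
          (~~ to_permutation T c).
Proof.
rewrite ffunE negb_and !negbK; apply: (iffP orP).
  case=> /existsP[y /and3P[h1 h2 /eqP h3]]; exists y.
    by left; rewrite (eqP h1).
  by right; rewrite (eqP h2).
case=> y [[e [le Ty]] | [le [e Ty]]]; [left | right]; apply/existsP; exists y.
  by rewrite e le Ty !eqxx.
by rewrite e le Ty !eqxx.
Qed.

Lemma alternative_alpha_uniq T x y : is_alternative T ->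
  T x = Some Alpha -> T y = Some Alpha -> col_of x = col_of y -> x = y.
Proof.
move=> /is_alternativeP[_ hA] Tx Ty e; apply: cell_eq => //.
case: (ltngtP (row_of x) (row_of y)) => // lt.
  by rewrite (hA y x) in Tx.
by rewrite (hA x y) in Ty.
Qed.

Lemma alternative_beta_uniq T x y : is_alternative T ->
  T x = Some Beta -> T y = Some Beta -> row_of x = row_of y -> x = y.
Proof.
move=> /is_alternativeP[hB _] Tx Ty e; apply: cell_eq => //.
case: (ltngtP (col_of x) (col_of y)) => // lt.
  by rewrite (hB y x) in Tx.
by rewrite (hB x y) in Ty.
Qed.

Lemma to_permutation_top T j : to_permutation T (top_cell j) = alpha_free T j.
Proof.
apply/negb_inj; apply/to_permutationPn/alpha_freePn => [[y [[//]|[_ [e Ty]]]] | [y e Ty]].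
  by exists y.
by exists y; right.
Qed.

Lemma to_permutation_alpha T x : is_alternative T -> T x = Some Alpha ->
  to_permutation T (low_cell x).
Proof.
move=> altT Tx; apply/negPn/to_permutationPn => -[y []].
  rewrite row_low col_low => -[[er] [le Ty]].
  have := le; rewrite leq_eqVlt => /orP[/eqP ec|lt].
    by rewrite (cell_eq er ec) Ty in Tx.
  by have /is_alternativeP[hB _] := altT; rewrite (hB y x) in Tx.
rewrite row_low col_low => -[lt [ec Ty]].
by rewrite (alternative_alpha_uniq altT Tx Ty ec) ltnn in lt.
Qed.

(** The one is found at the alpha of the column or, if there is none, in the first
    row.  No beta of the column lies above it, so that every beta is restricted. *)
Lemma to_permutation_column T j : is_alternative T -> j < n.+1 ->
  exists c, [/\ col_of c = j, to_permutation T c &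
    forall x, col_of x = j -> T x = Some Beta -> row_of c < (row_of x).+1].
Proof.
move=> altT ltj; have [/alpha_freePn[x ex Tx] | fr] := boolP (~~ alpha_free T j).
  exists (low_cell x); split; rewrite ?col_low ?row_low //.
    exact: to_permutation_alpha.
  move=> y ey Ty; rewrite ltnS; case: (ltngtP (row_of x) (row_of y)) => // [lt|e].
    have /is_alternativeP[_ hA] := altT.
    by rewrite (hA x y) // ?ey ?ex in Ty.
  by rewrite (@cell_eq _ x y) ?ex ?ey // Ty in Tx.
exists (top_cell (Ordinal ltj)); split; rewrite ?to_permutation_top //.
by move: fr; rewrite negbK.
Qed.

Lemma to_permutation_permutation T : is_alternative T -> is_permutation (to_permutation T).
Proof.
move=> altT; apply/is_permutationP; split.
  move=> j ltj; have lt : j < n.+1 by rewrite -(ncols_staircase n.+1).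
  by have [c [e Pc _]] := to_permutation_column altT lt; exists c.
move=> x y z Px Py Pz ec lr er lc.
have /to_permutationPn[w [[e [le Tw]]|[le [e Tw]]]] : ~~ to_permutation T z by rewrite Pz.
  suff : ~~ to_permutation T y by rewrite Py.
  by apply/to_permutationPn; exists w; left; rewrite er (leq_trans (ltnW lc)).
suff : ~~ to_permutation T x by rewrite Px.
by apply/to_permutationPn; exists w; right; rewrite ec (leq_trans (ltnW lr)).
Qed.

(** A one of a column with an alpha cannot be above the alpha, whose own cell is a one;
    in a column without an alpha the topmost one is in the first row. *)
Lemma topmost_to_permutation T x : is_alternative T ->
  topmost_one (to_permutation T) (low_cell x) = (T x == Some Alpha).
Proof.
move=> altT; apply/andP/eqP => [[Px nab] | Tx].
  have : ~~ alpha_free T (col_of x).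
    have lt : col_of x < n.+1 by have := staircase_cellP x; lia.
    apply/negP => fr; case/one_aboveP: nab; exists (top_cell (Ordinal lt)).
    by rewrite to_permutation_top.
  case/alpha_freePn => y ey Ty.
  case: (ltngtP (row_of x) (row_of y)) => [lt|lt|e].
  - suff : ~~ to_permutation T (low_cell x) by rewrite Px.
    by apply/to_permutationPn; exists y; right; rewrite row_low col_low ey.
  - case/one_aboveP: nab; exists (low_cell y).
    by rewrite !row_low !col_low ey to_permutation_alpha.
  - by rewrite (cell_eq e (esym ey)).
split; first exact: to_permutation_alpha.
apply/one_aboveP => -[c []]; rewrite col_low row_low => ec lt Pc.
suff : ~~ to_permutation T c by rewrite Pc.
by apply/to_permutationPn; exists x; right.
Qed.

(** The zero is not due to an alpha lower in the column, since that would also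
    annihilate the one above. *)
Lemma restricted_zero_beta T x : restricted_zero (to_permutation T) (low_cell x) ->
  exists y, [/\ row_of y = row_of x, col_of x <= col_of y & T y = Some Beta].
Proof.
case/andP=> Px /one_aboveP[c []]; rewrite col_low row_low => ec lt Pc.
case/to_permutationPn: Px => y [[]|[]]; rewrite row_low col_low.
  by move=> [er] [le Ty]; exists y.
move=> le [e Ty]; suff : ~~ to_permutation T c by rewrite Pc.
by apply/to_permutationPn; exists y; right; rewrite ec e; split=> //; lia.
Qed.

Lemma beta_restricted_zero T x : is_alternative T -> T x = Some Beta ->
  restricted_zero (to_permutation T) (low_cell x).
Proof.
move=> altT Tx; apply/andP; split.
  by apply/to_permutationPn; exists x; left; rewrite row_low col_low.
have lt : col_of x < n.+1 by have := staircase_cellP x; lia.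
have [c [ec Pc hc]] := to_permutation_column altT lt.
by apply/one_aboveP; exists c; rewrite col_low row_low; split=> //; exact: hc.
Qed.

(** A restricted zero has a beta at its place or to its right; the rightmost one is
    then that beta, which is itself a restricted zero. *)
Lemma to_permutationK T : is_alternative T -> to_alternative (to_permutation T) = T.
Proof.
move=> altT; apply/ffunP => x; rewrite ffunE topmost_to_permutation //.
case: eqP => [-> // | nA].
case: ifPn => [/andP[rx /existsPn nr] | ].
  have [y [er le Ty]] := restricted_zero_beta rx.
  move: le; rewrite leq_eqVlt => /orP[/eqP ec | lt].
    by rewrite -(cell_eq er (esym ec)).
  by have := nr y; rewrite left_ofE er eqxx lt beta_restricted_zero.
rewrite negb_and negbK; case Tx: (T x) nA => [[]|] // _.
rewrite beta_restricted_zero //= => /existsP[y /andP[]].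
rewrite left_ofE => /andP[/eqP er lt] /restricted_zero_beta[z [ez le Tz]].
have xz : x = z by apply: (alternative_beta_uniq altT Tx Tz); rewrite ez.
by move: lt le; rewrite xz; lia.
Qed.

Lemma to_alternative_alpha P x : (to_alternative P x == Some Alpha) = topmost_one P (low_cell x).
Proof. by rewrite ffunE; case: topmost_one => //; case: ifP. Qed.

Lemma to_alternative_beta P x :
  reflect (restricted_zero P (low_cell x) /\
           forall y, row_of x = row_of y -> col_of x < col_of y ->
             ~~ restricted_zero P (low_cell y))
          (to_alternative P x == Some Beta).
Proof.
rewrite ffunE /topmost_one /restricted_zero.
case Px: (P (low_cell x)); case: (one_above P (low_cell x)) => /=;
  try by apply: (iffP idP) => // -[].
apply: (iffP idP) => [|[_ h]].
  case: existsP => // nr _; split=> // y er lt; apply/negP => ry; case: nr; exists y.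
  by rewrite left_ofE er eqxx lt.
case: existsP => // -[y /andP[]]; rewrite left_ofE => /andP[/eqP er lt] ry.
by have := h y er lt; rewrite ry.
Qed.

(** A one to the left of a restricted zero is forbidden, so no alpha stands there; and
    a beta above an alpha would be a restricted zero, with a one above the topmost. *)
Lemma to_alternative_alternative P : is_permutation P -> is_alternative (to_alternative P).
Proof.
move=> /is_permutationP[_ hz]; apply/is_alternativeP; split=> x y.
  move=> /eqP/to_alternative_beta[rx nr] er lt.
  case Ay: (to_alternative P y) => [[]|] //; move/eqP: Ay.
    rewrite to_alternative_alpha => /andP[Py _].
    have /andP[/negbTE Px /one_aboveP[c [ec lc Pc]]] := rx.
    by case: (hz c (low_cell y) (low_cell x) Pc Py Px ec lc (congr1 succn er) lt).
  by case/to_alternative_beta=> _ /(_ x er lt); rewrite rx.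
move=> /eqP; rewrite to_alternative_alpha => /andP[Px /one_aboveP nab] ec lt.
case Ay: (to_alternative P y) => [[]|] //; move/eqP: Ay.
  rewrite to_alternative_alpha => /andP[Py _]; case: nab; exists (low_cell y).
  by rewrite !row_low !col_low ec.
case/to_alternative_beta=> /andP[_ /one_aboveP[c []]]; rewrite col_low row_low => e l Pc.
by move=> _; case: nab; exists c; rewrite row_low col_low e ec; split=> //; lia.
Qed.

Lemma rightmost_restricted_zero P x : restricted_zero P (low_cell x) ->
  exists y, [/\ row_of y = row_of x, col_of x <= col_of y
               & to_alternative P y = Some Beta].
Proof.
move=> rx.
pose Q := [pred y : cell (staircase n) | (row_of y == row_of x) && restricted_zero P (low_cell y)].
have Qx : Q x by rewrite /= eqxx.
case: (arg_maxnP (fun y => col_of y) Qx) => y /andP[/eqP er ry] ymax.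
exists y; split=> //; first exact: ymax.
apply/eqP/to_alternative_beta; split=> // z ez lt; apply/negP => rz.
by have /ymax : Q z by [rewrite /= -ez er eqxx]; rewrite /= leqNgt lt.
Qed.

Lemma topmost_one_column (D : diagram) (P : pfilling D) j :
  is_permutation P -> j < ncols D -> exists2 d, col_of d = j & topmost_one P d.
Proof.
move=> /is_permutationP[hcol _] /hcol[d0 ed0 Pd0].
pose Q := [pred d : cell D | (col_of d == j) && P d].
have Qd0 : Q d0 by rewrite /= ed0 eqxx.
case: (arg_minnP (fun d => row_of d) Qd0) => d /andP[/eqP ed Pd] dmin.
exists d; rewrite // /topmost_one Pd; apply/one_aboveP => -[z [ez lz Pz]].
by have /dmin : Q z by [rewrite /= ez ed eqxx]; rewrite /= leqNgt lz.
Qed.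

(** A zero lies above the topmost one of its column, which carries an alpha, or below
    it; then it is restricted, and its row has a beta there or further right. *)
Lemma to_alternativeK P : is_permutation P -> to_permutation (to_alternative P) = P.
Proof.
move=> permP; have /is_permutationP[_ hz] := permP.
apply/ffunP => c; apply/negb_inj; apply/idP/idP => [|nPc].
  case/to_permutationPn=> y [[er [le /eqP/to_alternative_beta[/andP[Py /one_aboveP[d [ed ld Pd]]] _]]]
                       | [le [ec /eqP]]].
    apply/negP => Pc; move: le; rewrite leq_eqVlt => /orP[/eqP e | lt].
      by rewrite -(@cell_eq _ c (low_cell y)) ?Pc // in Py.
    exact: (hz d c (low_cell y) Pd Pc (negbTE Py)).
  rewrite to_alternative_alpha => /andP[_ /one_aboveP nab]; apply/negP => Pc.
  by case: nab; exists c; rewrite row_low col_low.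
apply/to_permutationPn.
have [d ed td] := topmost_one_column permP (ltn_ord (cell_col c)).
have {}ed : col_of d = col_of c := ed.
have /andP[Pd _] := td.
case: (ltngtP (row_of d) (row_of c)) => [lt | lt | e]; last first.
- by rewrite -(cell_eq e ed) Pd in nPc.
- elim/stair_ind: d => [j | x] in ed td Pd lt * => //.
  exists x; right; split=> //; split=> //.
  by apply/eqP; rewrite to_alternative_alpha.
elim/stair_ind: c => [j | x] in nPc ed lt * => //.
have [|y [er le Ay]] := @rightmost_restricted_zero P x.
  by rewrite /restricted_zero nPc; apply/one_aboveP; exists d.
by exists y; left; rewrite row_low er.
Qed.

(** A first row cell is zero exactly when its column has an alpha, and then only one. *)
Lemma num_zeros_first_row_to_permutation T : is_alternative T ->
  num_zeros_first_row (to_permutation T) = num_alpha T.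
Proof.
move=> altT; rewrite /num_zeros_first_row /num_alpha.
pose up (x : cell (staircase n)) : cell (staircase n.+1) := top_cell (inord (col_of x)).
have col_up x : col_of (up x) = col_of x.
  by rewrite col_top inordK //; have := staircase_cellP x; lia.
rewrite -(card_in_imset (f := up)); last first.
  move=> x y; rewrite !inE => /eqP Tx /eqP Ty e.
  by apply: (alternative_alpha_uniq altT Tx Ty); rewrite -!col_up e.
apply: eq_card => c; rewrite inE; apply/andP/imsetP => [[/eqP r0 Pc] | [x + ->]].
  case/to_permutationPn: Pc => y [[]|[_ [ec Ty]]]; first by rewrite [row_of c]r0.
  by exists y; rewrite ?inE ?Ty //; apply: cell_eq; rewrite ?col_up.
rewrite inE => /eqP Tx; split=> //; rewrite to_permutation_top.
by apply/alpha_freePn; exists x => //; exact: esym (col_up x).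
Qed.

Lemma num_restricted_rows_to_permutation T : is_alternative T ->
  num_restricted_rows (to_permutation T) = num_beta T.
Proof.
move=> altT; rewrite /num_restricted_rows /num_beta.
rewrite -(card_in_imset (f := fun x => cell_row (low_cell x))); last first.
  move=> x y; rewrite !inE => /eqP Tx /eqP Ty /(congr1 val) [e].
  exact: (alternative_beta_uniq altT Tx Ty).
apply: eq_card => i; rewrite inE; apply/existsP/imsetP => [[c /andP[/eqP <-]] | [x + ->]].
  elim/stair_ind: c => [j /andP[_ /one_aboveP[d []]] // | x rx].
  have [y [er le Ty]] := restricted_zero_beta rx.
  by exists y; rewrite ?inE ?Ty //; apply: val_inj; rewrite /= er.
by rewrite inE => /eqP Tx; exists (low_cell x); rewrite eqxx beta_restricted_zero.
Qed.

(** An empty corner is a one of the permutation tableau, as no arrow can reach it, and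
    it is not a topmost one. *)
Lemma num_superfluous_corners_to_permutation T : is_alternative T ->
  num_superfluous_corners (to_permutation T) = num_empty_corners T.
Proof.
move=> altT; rewrite /num_superfluous_corners /num_empty_corners.
rewrite -(card_imset _ (@low_cell_inj n)).
apply: eq_card => c; rewrite inE; apply/andP/imsetP => [[] | [x + ->]].
  elim/stair_ind: c => [j _ /andP[Pj] | x].
    by rewrite /topmost_one Pj /= negbK => /one_aboveP[d []].
  rewrite corner_low => cx /andP[Px]; rewrite topmost_to_permutation // => nA.
  exists x => //; rewrite inE cx /=; case Tx: (T x) nA => [[]|] // _.
  by have /andP[] := beta_restricted_zero altT Tx; rewrite Px.
rewrite inE => /andP[cx /eqP Tx]; rewrite corner_low; split=> //.
rewrite /superfluous_one topmost_to_permutation // Tx andbT.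
apply/negPn/to_permutationPn => -[y]; rewrite row_low col_low.
move: cx; rewrite cornerE => /eqP cx; have ly := staircase_cellP y.
by case=> [[[er] [le Ty]]|[lt [ec Ty]]]; last lia;
  rewrite (@cell_eq _ x y) ?Ty // in Tx; lia.
Qed.

End Bijection.

Theorem theorem5 (F : fieldType) (alpha beta gamma : F) (n : nat)
    (halpha : alpha != 0) (hbeta : beta != 0) (hgamma : gamma != 0)
    (hn : (1 <= n)%N) :
  (alpha * beta * gamma) ^+ n
    * eval3 (dumont_foata n.+1) alpha^-1 beta^-1 gamma^-1
  = \sum_(T : afilling (staircase n) | is_alternative T)
      alpha ^+ num_alpha T * beta ^+ num_beta T * gamma ^+ num_empty_corners T
  /\
  (alpha * beta * gamma) ^+ n
    * eval3 (dumont_foata n.+1) alpha^-1 beta^-1 gamma^-1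
  = \sum_(T : pfilling (staircase n.+1) | is_permutation T)
      alpha ^+ num_zeros_first_row T * beta ^+ num_restricted_rows T
        * gamma ^+ num_superfluous_corners T.
Proof.
have altE : (alpha * beta * gamma) ^+ n
    * eval3 (dumont_foata n.+1) alpha^-1 beta^-1 gamma^-1
  = \sum_(T : afilling (staircase n) | is_alternative T)
      alpha ^+ num_alpha T * beta ^+ num_beta T * gamma ^+ num_empty_corners T.
  rewrite -[alpha^-1]mul1r -alternative_sumE //; apply: eq_bigr => T _.
  rewrite prod_entry_weight [X in _ * X]big1 ?mulr1 // => j _.
  by case: ifP.
split=> //; rewrite altE.
rewrite [RHS](reindex_onto (@to_permutation n) (@to_alternative n)); last exact: to_alternativeK.
apply: eq_big => [T | T altT]; last first.
  by rewrite num_zeros_first_row_to_permutation // num_restricted_rows_to_permutation //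
             num_superfluous_corners_to_permutation.
apply/idP/andP => [altT | [permT /eqP <-]].
  by rewrite to_permutation_permutation // to_permutationK.
exact: to_alternative_alternative.
Qed.
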